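(* Let $\ell\in\{1,2\}$, let $k\ge1$, $n=k+\ell-1$, and let $U\in\mathcal G_k\mathcal P_n$ be a subspace of codimension $\ell$ in $\mathcal P_n$. Suppose that $W(U)=W\big(U^{(\ell-1)}\big)^{\ell}$ up to a nonzero scalar multiple, and that $W\big(U^{(\ell-1)}\big)$ has $k$ distinct finite, simple roots. Then $U$ admits a basis of top powers.
   Context: Work over $\mathbb C$. $\mathcal P_n$ is the vector space of polynomials in $z$ of degree $\le n$; $\mathcal G_k\mathcal P_n$ is the Grassmannian of $k$-dimensional subspaces of $\mathcal P_n$. A top power in $\mathcal P_n$ is a polynomial of the form $(az+b)^n$ with $(a,b)\neq(0,0)$. $U^{(j)}$ denotes the span of the $j$th derivatives of the elements of $U$ (so $U^{(0)}=U$). For a finite-dimensional polynomial subspace $V$ with basis $p_1,\dots,p_r$, $W(V)$ is the Wronskian $\det(p_i^{(j-1)})_{1\le i,j\le r}$, a nonzero polynomial defined up to a nonzero scalar multiple. *)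

(* Defs.v *)
From HB Require Import structures.
From mathcomp Require Import all_boot all_order all_algebra.
From mathcomp Require Import qpoly complex reals.

Set Implicit Arguments.
Unset Strict Implicit.
Unset Printing Implicit Defensive.

Import GRing.Theory.
Local Open Scope ring_scope.

(* [{poly_m F}] consists of the polynomials of *size* at most m, so the space
   P_n of polynomials of degree at most n is [{poly_n.+1 F}]. *)

Section Wronskian.
Variable F : fieldType.

Definition wronskian (m r : nat) (p : r.-tuple {poly_m F}) : {poly F} :=
  \det (\matrix_(i < r, j < r) (tnth p i : {poly F})^`(j)).

(* A representative of the Wronskian of V, up to a nonzero scalar: by
   [wronskian_basis] below, any other basis gives an associate polynomial.
   Over a field, [%=] is equality up to a nonzero constant. *)
Definition Wr (m : nat) (V : {vspace {poly_m F}}) : {poly F} :=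
  wronskian (vbasis V).

Lemma wronskian_dvdp (m r : nat) (V : {vspace {poly_m F}})
    (b c : r.-tuple {poly_m F}) :
  basis_of V b -> basis_of V c -> wronskian b %| wronskian c.
Proof.
move=> bV cV.
pose M := \matrix_(i < r, j < r) (coord b j (tnth c i))%:P.
suff -> : wronskian c = \det M * wronskian b by rewrite dvdp_mull.
rewrite -det_mulmx; congr (\det _); apply/matrixP=> i j; rewrite !mxE.
have ci : tnth c i \in V by apply: (basis_mem cV); exact: mem_tnth.
rewrite {1}(coord_basis bV ci) raddf_sum /= linear_sum.
by apply: eq_bigr => l _; rewrite !mxE linearZ /= mul_polyC !(tnth_nth 0).
Qed.

Lemma wronskian_basis (m r : nat) (V : {vspace {poly_m F}})
    (b : r.-tuple {poly_m F}) :
  basis_of V b -> wronskian b %= Wr V.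
Proof.
move=> bV.
have rV : r = \dim V.
  by rewrite -(span_basis bV) (eqP (basis_free bV)) size_tuple.
subst r.
by apply/andP; split; apply: (@wronskian_dvdp _ _ V) => //; apply: vbasisP.
Qed.

End Wronskian.

Section Derivatives.
Variables (F : fieldType) (m : nat).
Implicit Types (p : {poly_m F}) (V : {vspace {poly_m F}}).

Definition nderivn (j : nat) p : {poly_m F} := npolyp m (p : {poly F})^`(j).

Lemma nderivnE j p : nderivn j p = (p : {poly F})^`(j) :> {poly F}.
Proof.
apply: npolypK; apply: leq_trans (size_npoly p).
elim: j => [|j IHj]; first by rewrite derivn0.
by rewrite derivnS (leq_trans _ IHj) // (leq_trans (size_poly _ _)) ?leq_pred.
Qed.

Fact nderivn_is_linear j : linear (nderivn j).
Proof.
move=> a p q; apply/val_inj => /=.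
by rewrite nderivnE /= !nderivnE /= derivnD derivnZ.
Qed.

HB.instance Definition _ j :=
  GRing.isLinear.Build F {poly_m F} {poly_m F} _ (nderivn j)
    (nderivn_is_linear j).

(* The j-th derivatives of the elements of V already form a subspace, namely
   the image of V by the j-th derivative. *)
Definition derivs (j : nat) V : {vspace {poly_m F}} :=
  (linfun (nderivn j) @: V)%VS.

Lemma mem_derivs j V (q : {poly_m F}) :
  reflect (exists2 p, p \in V & q = (p : {poly F})^`(j) :> {poly F})
          (q \in derivs j V).
Proof.
apply: (iffP memv_imgP) => -[p pV pq]; exists p => //.
  by rewrite pq lfunE /= nderivnE.
by apply/val_inj; rewrite /= lfunE /= pq nderivnE.
Qed.

End Derivatives.

Definition top_power (F : fieldType) (n : nat) (p : {poly F}) : Prop :=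
  exists a b : F, (a, b) <> (0, 0) /\ p = (a *: 'X + b%:P) ^+ n.

Definition simple_root (F : fieldType) (p : {poly F}) (x : F) : bool :=
  mup x p == 1%N.

(* Main.v *)
Require Import Defs.
From HB Require Import structures.
From mathcomp Require Import all_boot all_order all_algebra.
From mathcomp Require Import qpoly complex reals.
From mathcomp Require Import perm zify.

Set Implicit Arguments.
Unset Strict Implicit.
Unset Printing Implicit Defensive.

Import GRing.Theory.
Local Open Scope ring_scope.

(** A root s of the Wronskian of a k-dimensional space U of polynomials means
    that some nonzero element of U vanishes at s to order at least k
    ([dvdp_of_root_Wr]). The proof shows that at each of the k given roots s
    this element is a multiple of (X - s)^n. The k powers so obtained are
    linearly independent ([free_XsubC_exp]), hence form a basis of U.

    If U is a hyperplane, then n = k and an element of order n at s is a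
    multiple of (X - s)^n for degree reasons ([XsubC_exp_mem]).

    If U has codimension 2, then n = k + 1, and the degree leaves room for
    an element p of order exactly k at s. Let U' be the space of derivatives. It
    has dimension k: otherwise U contains the constants, W(U) is associate to
    W(U') ([Wr_derivs1_const]) as well as to its square, and W(U') has no root.
    So U' is a hyperplane in the polynomials of degree at most k, and contains
    (X - s)^k by the first case. If p had order exactly k, then U' would contain
    both p', of order k - 1, and (X - s)^k, and its Wronskian would have a
    double root at s ([dvdp_sqr_Wr]), contrary to simplicity
    ([XsubC_exp_mem_codim2]).
    The relation between W(U) and the square of W(U') thus enters twice: it
    excludes the constants, and it makes the roots of W(U') roots of W(U). *)

(** * Order of vanishing at a point *)

(** Each derivative lowers the order of vanishing at s by at most one. The
    truncated subtraction covers the case j >= m, where nothing is claimed. *)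
Lemma dvdp_derivn_XsubC (F : fieldType) (s : F) (m j : nat) (p : {poly F}) :
  ('X - s%:P) ^+ m %| p -> ('X - s%:P) ^+ (m - j) %| p^`(j).
Proof.
elim: j => [|j IHj] dvd_p; first by rewrite subn0 derivn0.
have /dvdpP[q pE] := IHj dvd_p; rewrite derivnS pE derivM.
apply: dvdp_add.
  by apply/dvdp_mull/dvdp_exp2l; rewrite subnS leq_pred.
rewrite dvdp_mull // deriv_exp -mulr_natl dvdp_mull // derivXsubC mul1r.
by rewrite subnS.
Qed.

(** The only term of the Leibniz rule that survives at s is the one in which
    every derivative falls on the power of X - s. *)
Lemma derivn_mul_XsubC_exp (F : fieldType) (s : F) (m : nat) (q : {poly F}) :
  ((q * ('X - s%:P) ^+ m)^`(m)).[s] = (m`!)%:R * q.[s].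
Proof.
elim: m q => [|m IHm] q; first by rewrite derivn0 expr0 mulr1 mul1r.
have -> : (q * ('X - s%:P) ^+ m.+1)^`(m.+1) =
    ((q^`() * ('X - s%:P) + m.+1%:R *: q) * ('X - s%:P) ^+ m)^`(m).
  rewrite derivSn; congr (_^`(m)).
  rewrite derivM deriv_exp derivXsubC mul1r -pred_Sn mulrDl -mulrA -exprS.
  by rewrite -scalerAl scaler_nat mulrnAr.
by rewrite IHm !hornerE subrr mulr0 add0r mulrA -natrM mulnC factS.
Qed.

(** In characteristic 0 the order of vanishing at s can be read off the
    successive derivatives at s; in characteristic p, X^p - s^p with m > p is
    a counterexample. *)
Lemma dvdp_XsubC_exp_derivn (F : fieldType) (s : F) (m : nat) (p : {poly F}) :
    has_pchar0 F -> (forall j, (j < m)%N -> (p^`(j)).[s] = 0) ->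
  ('X - s%:P) ^+ m %| p.
Proof.
move=> /pcharf0P F0; elim: m => [|m IHm] p0; first by rewrite expr0 dvd1p.
have /dvdpP[q pE] := IHm (fun j jm => p0 j (ltnW jm)).
have /eqP := p0 m (ltnSn m); rewrite pE derivn_mul_XsubC_exp mulf_eq0 F0.
rewrite eqn0Ngt fact_gt0 /= -[_ == 0]/(root q s) -dvdp_XsubCl => q0.
by rewrite exprS dvdp_mul.
Qed.

(** Below degree n + 1, the power of X - s is the only polynomial of order n
    at s, up to a scalar, and a subspace is closed under rescaling. *)
Lemma XsubC_exp_mem_dvdp (F : fieldType) (m n : nat) (V : {vspace {poly_m F}})
    (s : F) (p : {poly_m F}) :
    p \in V -> p != 0 -> (size p <= n.+1)%N ->
    ('X - s%:P) ^+ n %| (p : {poly F}) ->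
  exists2 r : {poly_m F}, r \in V & (r : {poly F}) = ('X - s%:P) ^+ n.
Proof.
move=> pV p_neq0 sz_p /dvdpP[q pE].
have q_neq0 : q != 0.
  apply: contraNneq p_neq0 => q0.
  by apply/eqP/val_inj; rewrite /= pE q0 mul0r.
have /size_poly1P[a a_neq0 qE] : size q == 1%N.
  move: sz_p; rewrite pE size_mul ?expf_neq0 ?polyXsubC_eq0 //.
  rewrite size_exp_XsubC addnS /= -add1n leq_add2r.
  by rewrite eqn_leq size_poly_gt0 q_neq0 andbT.
exists (a^-1 *: p); first exact: memvZ.
by rewrite /= pE qE mul_polyC scalerA mulVf // scale1r.
Qed.

(** * Wronskians and orders of vanishing *)

(** A root s of the Wronskian makes the matrix of the values of the
    derivatives at s singular. A row vector in its left kernel is a nonzero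
    element of V whose first dim V derivatives vanish at s, one order of
    vanishing more than a space of that dimension can always achieve. *)
Lemma dvdp_of_root_Wr (F : fieldType) (m : nat) (V : {vspace {poly_m F}})
    (s : F) : has_pchar0 F -> root (Wr V) s ->
  exists p : {poly_m F},
    [/\ p \in V, p != 0 & ('X - s%:P) ^+ \dim V %| (p : {poly F})].
Proof.
move=> F0; rewrite /root /Wr /wronskian -horner_evalE -det_map_mx.
case/det0P=> v v0 vM0.
have bV := vbasisP V.
pose p := \sum_i v 0 i *: (vbasis V)`_i.
have pE j : (p : {poly F})^`(j) =
    \sum_i v 0 i *: ((tnth (vbasis V) i : {poly F})^`(j)).
  rewrite /p raddf_sum linear_sum; apply: eq_bigr => i _.
  by rewrite -derivnZ (tnth_nth 0).
exists p; split.
- apply: memv_suml => i _.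
  by rewrite memvZ // (basis_mem bV) ?mem_nth ?size_tuple.
- apply: contraNneq v0 => p0; apply/eqP/rowP => i; rewrite mxE.
  by have /freeP/(_ (v 0) p0) := basis_free bV.
apply: dvdp_XsubC_exp_derivn => // j jV.
have /rowP/(_ (Ordinal jV)) := vM0; rewrite !mxE => <-.
rewrite pE horner_sum; apply: eq_bigr => i _.
by rewrite hornerZ !mxE.
Qed.

(** If independent elements have orders at least dim V - 1 and dim V at s, the
    orders occurring in V at s exceed 0, 1, .., dim V - 1 by at least 2 in
    total, and the Wronskian vanishes doubly at s. *)
Lemma dvdp_sqr_Wr (F : fieldType) (m : nat) (V : {vspace {poly_m F}})
    (q r : {poly_m F}) (s : F) :
    q \in V -> r \in V -> free [:: q; r] ->
    ('X - s%:P) ^+ (\dim V).-1 %| (q : {poly F}) ->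
    ('X - s%:P) ^+ \dim V %| (r : {poly F}) ->
  ('X - s%:P) ^+ 2 %| Wr V.
Proof.
move=> qV rV qr_free dq dr.
set d := \dim V in dq dr.
set W := <<[:: q; r]>>%VS.
have WV : (W <= V)%VS.
  by apply/span_subvP => x; rewrite !inE => /orP[]/eqP->.
pose c := [:: q, r & vbasis (V :\: W)].
have cV : basis_of V c.
  have -> : V = (W + (V :\: W))%VS.
    by rewrite addvC addv_diff; apply/esym/addv_idPl.
  apply: (@cat_basis _ _ W (V :\: W)%VS [:: q; r]).
  - by apply/directv_addP; rewrite capvC capv_diff.
  - by rewrite /basis_of qr_free eqxx.
  - exact: vbasisP.
have sz_c : size c = d.
  by rewrite -(eqP (basis_free cV)) (span_basis cV).
(* Every term of the Leibniz formula is divisible by the square: the rows of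
   q and r contribute orders at least d - 1 - sigma i0 and d - sigma i1, and
   sigma i0 and sigma i1 cannot both be d - 1. *)
rewrite -(eqp_dvdr _ (wronskian_basis (b := in_tuple c) cV)) /wronskian.
rewrite /determinant; apply: (big_ind (fun p => _ %| p)) => [||sigma _].
- exact: dvdp0.
- by move=> x y; apply: dvdp_add.
pose i0 : 'I_(size c) := @Ordinal (size c) 0 isT.
pose i1 : 'I_(size c) := @Ordinal (size c) 1 isT.
have i10 : i1 != i0 by [].
rewrite (bigD1 i0) //= (bigD1 i1) //= dvdp_mull // mulrA dvdp_mulr //.
rewrite !mxE !(tnth_nth 0) /=.
have neq : sigma i1 != sigma i0 by rewrite (inj_eq perm_inj).
have := dvdp_derivn_XsubC (sigma i0) dq.
have := dvdp_derivn_XsubC (sigma i1) dr.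
move=> d1 d0; apply: dvdp_trans (dvdp_mul d0 d1).
rewrite -exprD dvdp_exp2l //.
move: (ltn_ord (sigma i0)) (ltn_ord (sigma i1)) neq.
rewrite -val_eqE /= -[size (vbasis _)]/(size c).-2 -/d.
move: (nat_of_ord (sigma i0)) (nat_of_ord (sigma i1)) => x y.
have := sz_c; rewrite /c /=; lia.
Qed.

(** * Independence of top powers *)

Lemma derivn_XsubC_exp (F : fieldType) (c : F) (n j : nat) :
  (('X - c%:P) ^+ n)^`(j) = ('X - c%:P) ^+ (n - j) *+ n ^_ j.
Proof.
elim: j => [|j IHj]; first by rewrite derivn0 subn0.
rewrite derivnS IHj derivMn deriv_exp derivXsubC mul1r -mulrnA -subnS.
by rewrite ffactnSr mulnC.
Qed.

(** Differentiating a linear relation between powers n - j times and evaluating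
    at 0 gives a relation between the j-th powers of the opposites of the
    centres; the Vandermonde determinant excludes a nontrivial one. *)
Lemma free_XsubC_exp (F : fieldType) (n k : nat) (s : k.-tuple F) :
    has_pchar0 F -> (k <= n.+1)%N -> uniq s ->
  free [seq npolyp n.+1 (('X - c%:P) ^+ n) | c <- s].
Proof.
move=> /pcharf0P F0 kn s_uniq.
apply/(@freeP _ _ _ [tuple of map _ s]) => a /(congr1 val) /= a0 i.
pose v : 'rV[F]_k := \row_i a i.
suff v0 : v = 0 by have /rowP/(_ i) := v0; rewrite !mxE.
apply/eqP; apply: contraTT isT => v0.
pose A := Vandermonde k (\row_i (- tnth s i)).
have : \det A^T == 0.
  apply/det0P; exists v => //; apply/rowP=> j; rewrite !mxE.
  have jn : (j <= n)%N by rewrite -ltnS (leq_trans (ltn_ord j)).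
  have /(congr1 (fun p : {poly F} => (p^`(n - j)).[0])) := a0.
  rewrite raddf_sum linear_sum horner_sum linear0 horner0 => e.
  have /mulfI : (n ^_ (n - j))%:R != 0 :> F.
    by rewrite F0 -lt0n ffact_gt0 leq_subr.
  apply.
  rewrite mulr0 -[RHS]e mulr_sumr.
  apply: eq_bigr => l _; rewrite !mxE.
  rewrite (nth_map 0) ?size_tuple //= derivnZ hornerZ npolypK; last first.
    by rewrite size_exp_XsubC.
  rewrite derivn_XsubC_exp hornerMn horner_exp hornerXsubC sub0r subKn //.
  by rewrite -tnth_nth mulr_natl mulrnAr.
rewrite det_tr det_Vandermonde => /prodf_eq0[x _ /prodf_eq0[y xy]].
rewrite !mxE opprK addrC subr_eq0 => /eqP xyE.
by move/tuple_uniqP: s_uniq xy => /(_ _ _ xyE) ->; rewrite ltnn.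
Qed.

(** * Spaces of derivatives and membership of top powers *)

Lemma polyC_of_deriv0 (F : fieldType) (p : {poly F}) :
  has_pchar0 F -> p^`() = 0 -> p = (p`_0)%:P.
Proof.
move=> /pcharf0P F0 p'0; apply/polyP => -[|i]; rewrite coefC //=.
have /eqP := congr1 (fun q : {poly F} => q`_i) p'0.
by rewrite coef_deriv coef0 -mulr_natr mulf_eq0 F0 orbF => /eqP.
Qed.

(** The zero polynomial has no simple root because its multiplicity is 0
    everywhere. *)
Lemma simple_rootP (F : fieldType) (p : {poly F}) (s : F) :
  simple_root p s -> [/\ p != 0, root p s & ~~ (('X - s%:P) ^+ 2 %| p)].
Proof.
move=> /eqP mu1.
have p0 : p != 0.
  apply: contra_eq_neq mu1 => ->; rewrite /mup.
  by move: [arg max_(_ > _ | _) _] => /=; rewrite size_poly0 => -[[|]].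
split=> //; last by rewrite -mup_ltn // mu1.
by apply: contra_eqT mu1 => /mupNroot ->.
Qed.

(** The dimension drops only if U contains a nonzero constant a. In a basis
    that starts with a, the Wronskian matrix has first row (a, 0, .., 0), and
    removing that row and the first column leaves the Wronskian matrix of the
    derivatives of the other basis elements. *)
Lemma Wr_derivs1_const (F : fieldType) (m : nat) (U : {vspace {poly_m F}}) :
    has_pchar0 F -> (\dim (derivs 1 U) < \dim U)%N ->
  Wr U %= Wr (derivs 1 U).
Proof.
move=> F0 dimU; set f : 'End({poly_m F}) := linfun (@Defs.nderivn F m 1).
have fE p : (f p : {poly F}) = (p : {poly F})^`().
  by rewrite lfunE /= nderivnE derivn1.
set K := (U :&: lker f)%VS.
have K0 : K != 0%VS.
  rewrite -dimv_eq0; apply: contraL dimU => /eqP K0.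
  by rewrite -leqNgt -(limg_ker_dim f U) -/K K0.
have constK p : p \in K -> (p : {poly F}) = ((p : {poly F})`_0)%:P.
  rewrite memv_cap memv_ker => /andP[_ /eqP fp0].
  by apply: polyC_of_deriv0 => //; rewrite -fE fp0.
pose c := vpick K.
have cK : c \in K by apply: memv_pick.
have c0 : c != 0 by rewrite vpick0.
pose a := (c : {poly F})`_0.
have cE : (c : {poly F}) = a%:P by apply: constK.
have a0 : a != 0.
  by apply: contraNneq c0 => a0; apply/eqP/val_inj; rewrite /= cE a0.
have cKb : basis_of K [:: c].
  rewrite basisEdim span_seq1 lt0n dimv_eq0 K0 andbT.
  apply/subvP => p pK; apply/vlineP; exists ((p : {poly F})`_0 / a).
  apply/val_inj; rewrite /= cE (constK p pK) coefC eqxx /=.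
  by rewrite -mul_polyC -polyCM divfK.
pose X := vbasis (U :\: lker f).
have fXb : basis_of (derivs 1 U) [tuple of map f X].
  rewrite /derivs -/f -limg_ker_compl; apply: limg_basis_of (vbasisP _).
  exact: capv_diff.
have cXb : basis_of U [tuple of c :: X].
  rewrite -[U in basis_of U _](addv_diff_cap U (lker f)) addvC.
  apply: (cat_basis _ cKb (vbasisP _)).
  apply/directv_addP/eqP; rewrite -subv0 -(capv_diff U (lker f)) capvC.
  by apply: capvS => //; apply: capvSr.
rewrite -(eqp_ltrans (wronskian_basis cXb)) -(eqp_rtrans (wronskian_basis fXb)).
suff -> : wronskian [tuple of c :: X] = a%:P * wronskian [tuple of map f X].
  by rewrite mul_polyC eqp_scale.
rewrite /wronskian (expand_det_row _ ord0) big_ord_recl.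
rewrite big1 => [|j _]; last first.
  by rewrite mxE (tnth_nth 0) lift0 /= cE -derivnS derivnC mul0r.
rewrite addr0 mxE (tnth_nth 0) /= cE; congr (_ * _).
rewrite /cofactor /= expr0 mul1r; congr (\det _); apply/matrixP => i j.
rewrite !mxE !(tnth_nth 0) /= (nth_map 0) ?size_tuple // fE -derivSn.
by [].
Qed.

(** This is the hyperplane case: the condition on sizes says that V lies in a
    space of polynomials of dimension dim V + 1, in which order dim V at s
    forces a top power. *)
Lemma XsubC_exp_mem (F : fieldType) (m : nat) (V : {vspace {poly_m F}})
    (s : F) :
    has_pchar0 F ->
    (forall p : {poly_m F}, p \in V -> (size p <= (\dim V).+1)%N) ->
    root (Wr V) s ->
  exists2 p : {poly_m F}, p \in V & (p : {poly F}) = ('X - s%:P) ^+ \dim V.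
Proof.
move=> F0 szV /dvdp_of_root_Wr[//|p [pV p0 dvd_p]].
exact: XsubC_exp_mem_dvdp (szV p pV) dvd_p.
Qed.

(** Set k = dim U. The root s of the Wronskian of U gives a nonzero p in U of
    degree at most k + 1 and order at least k at s. If the order were exactly
    k, then p' would have order k - 1 at s, and the space of derivatives, a
    hyperplane in degrees up to k, also contains the power (X - s)^k; its
    Wronskian would then have a double root at s. Hence p has order k + 1. *)
Lemma XsubC_exp_mem_codim2 (F : fieldType) (m : nat)
    (U : {vspace {poly_m F}}) (s : F) :
    has_pchar0 F -> (0 < \dim U)%N -> \dim (derivs 1 U) = \dim U ->
    (forall p : {poly_m F}, p \in U -> (size p <= (\dim U).+2)%N) ->
    root (Wr U) s -> simple_root (Wr (derivs 1 U)) s ->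
  exists2 p : {poly_m F}, p \in U & (p : {poly F}) = ('X - s%:P) ^+ (\dim U).+1.
Proof.
move=> F0; set k := \dim U => k0 dimU' szU /dvdp_of_root_Wr[//|p [pU p0]].
rewrite -/k => dvd_p /simple_rootP[_ Ws Ws2].
have [r rU' rE] : exists2 r : {poly_m F}, r \in derivs 1 U &
    (r : {poly F}) = ('X - s%:P) ^+ k.
  rewrite -[in _ ^+ k]dimU'; apply: XsubC_exp_mem => // q.
  case/mem_derivs => u uU ->; rewrite dimU' derivn1.
  by apply: leq_trans (size_poly _ _) _; rewrite -subn1 leq_subLR szU.
have /dvdpP[g pE] := dvd_p.
have [g_s|g_s] := boolP (root g s).
  apply: (@XsubC_exp_mem_dvdp _ _ _ _ _ p) => //; first exact: szU.
  by rewrite pE exprS dvdp_mul // dvdp_XsubCl.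
case/negP: Ws2.
have p'E : (Defs.nderivn 1 p : {poly F}) = (p : {poly F})^`(1).
  by rewrite nderivnE.
apply: (@dvdp_sqr_Wr _ _ _ (Defs.nderivn 1 p) r); rewrite ?dimU' //.
- by apply/mem_derivs; exists p.
- rewrite free_cons seq1_free span_seq1; apply/andP; split; last first.
    apply/eqP => r0; have /eqP := rE.
    by rewrite r0 /= eq_sym expf_eq0 polyXsubC_eq0 andbF.
  (* If p' were a multiple of r, it would have order k at s,
     and g would vanish at s. *)
  apply: contra g_s => /vlineP[a pr].
  have dvd_p' : ('X - s%:P) ^+ k %| (p : {poly F})^`(1).
    by rewrite -p'E pr /= rE -mul_polyC dvdp_mull.
  have := dvdp_derivn_XsubC k.-1 dvd_p'.
  have -> : (k - k.-1 = 1)%N by lia.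
  rewrite expr1 dvdp_XsubCl.
  rewrite derivn1 -derivSn prednK // pE /root derivn_mul_XsubC_exp mulf_eq0.
  by rewrite (pcharf0P _).1 // eqn0Ngt fact_gt0.
- by rewrite p'E -subn1; apply: dvdp_derivn_XsubC.
- by rewrite rE.
Qed.

Theorem mainTheorem8 (R : realType) (l k n : nat)
    (hl : l = 1%N \/ l = 2%N) (hk : (1 <= k)%N) (hn : n = (k + l - 1)%N)
    (U : {vspace {poly_n.+1 R[i]}})
    (hdim : \dim U = k)
    (hcodim : \dim {: {poly_n.+1 R[i]}} = (\dim U + l)%N)
    (hW : Wr U %= Wr (derivs l.-1 U) ^+ l)
    (hroots : exists s : seq R[i],
        [/\ uniq s, size s = k & all (simple_root (Wr (derivs l.-1 U))) s]) :
  exists b : k.-tuple {poly_n.+1 R[i]},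
    basis_of U b /\ (forall p, p \in b -> top_power n (p : {poly R[i]})).
Proof.
have F0 : has_pchar0 R[i] by apply: Num.Theory.pchar_num.
case: hroots => s [s_uniq /eqP s_size /allP s_root].
have kn : (k <= n.+1)%N by rewrite hn; case: hl => ->; lia.
suff powU c : c \in s ->
    exists2 p : {poly_n.+1 R[i]},
      p \in U & (p : {poly R[i]}) = ('X - c%:P) ^+ n.
  pose b := [tuple of [seq npolyp n.+1 (('X - c%:P) ^+ n) | c <- Tuple s_size]].
  have bE c : (npolyp n.+1 (('X - c%:P) ^+ n) : {poly R[i]}) = ('X - c%:P) ^+ n.
    by rewrite npolypK ?size_exp_XsubC.
  exists b; split; last first.
    move=> _ /mapP[c _ ->]; rewrite bE; exists 1, (- c); split.
      by case=> /eqP; rewrite oner_eq0.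
    by rewrite scale1r polyCN.
  rewrite basisEfree free_XsubC_exp //= size_map (eqP s_size) hdim leqnn andbT.
  apply/span_subvP => _ /mapP[c /powU[p pU pE] ->].
  by rewrite (_ : npolyp _ _ = p) //; apply/val_inj; rewrite /= bE pE.
move=> /s_root c_root.
have [q0 qc _] := simple_rootP c_root.
have Uc : root (Wr U) c.
  rewrite (eqp_root hW) /root horner_exp expf_eq0 -/(root _ c) qc andbT.
  by case: hl => ->.
case: hl => lE; subst l n.
  have nE : (k + 1 - 1)%N = \dim U by rewrite hdim addnK.
  rewrite [X in _ ^+ X]nE; apply: XsubC_exp_mem => // p pU.
  by rewrite -nE size_npoly.
have leU : (\dim (derivs 1 U) <= \dim U)%N.
  by rewrite -(limg_ker_dim (linfun (Defs.nderivn 1)) U) leq_addl.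
have dimU' : \dim (derivs 1 U) = \dim U.
  apply/eqP; rewrite eqn_leq leU /=.
  (* Otherwise both Wronskians and the square of the second are associate, so
     that the second is constant, contrary to its having a root. *)
  rewrite leqNgt; apply/negP => ltU.
  have /eqp_size sz_eq : Wr (derivs 1 U) %= Wr (derivs 1 U) ^+ 2.
    by rewrite -(eqp_ltrans (Wr_derivs1_const F0 ltU)).
  have := size_exp (Wr (derivs 1 U)) 2; rewrite -sz_eq.
  by have := root_size_gt1 q0 qc; move: (size _) => z; lia.
have nE : (k + 2 - 1)%N = (\dim U).+1 by rewrite hdim; lia.
have [||p pU pE] := XsubC_exp_mem_codim2 F0 _ dimU' _ Uc c_root.
- by rewrite hdim.
- by move=> p _; rewrite -nE size_npoly.
by exists p; rewrite // pE -nE.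
Qed.
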